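(* For all $t>0$, $$\frac{e^t}{1+2t}<I_0(t)<\frac{e^t}{\sqrt{1+2t}},$$ or equivalently, $$\frac{b}{1+\ln(b/a)}<TQ(a,b)<\frac{b}{\sqrt{1+\ln(b/a)}}$$ for all $b>a>0$. Consequently, $$\lim_{t\to\infty}e^{-t}I_0(t)=0,$$ or $\lim_{x\to0^+}TQ(x,1)=0$.
   Context: $I_0(t)=\sum_{n=0}^{\infty}\frac{t^{2n}}{2^{2n}(n!)^2}$ denotes the modified Bessel function of the first kind of order $0$. For $a,b>0$, $TQ(a,b)=\frac2\pi\int_0^{\pi/2}a^{\cos^2\theta}b^{\sin^2\theta}\,d\theta$ is the Toader-Qi mean. *)

(* Defs.v *)
From Stdlib Require Import Reals Factorial.
From Coquelicot Require Import Coquelicot.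
Open Scope R_scope.

(** Stdlib real numbers with Coquelicot's series, integrals and limits. *)

(** Modified Bessel function of the first kind of order 0.  [Series] is total;
    the series below converges for every [t]. *)
Definition I0 (t : R) : R :=
  Series (fun n : nat => t ^ (2 * n) / (2 ^ (2 * n) * (INR (fact n)) ^ 2)).

(** Toader-Qi mean, meant for [a, b > 0] ([Rpower x y] is [exp (y * ln x)]). *)
Definition TQ (a b : R) : R :=
  2 / PI * RInt (fun theta : R => Rpower a ((cos theta) ^ 2) * Rpower b ((sin theta) ^ 2))
                0 (PI / 2).

(* Main.v *)
Require Import Defs.
From Stdlib Require Import Reals Lra Lia Factorial.
From Coquelicot Require Import Coquelicot.
Open Scope R_scope.

(** Everything rests on one integral: with
    [K L = exp_cos2_integral L], the integral of [exp (- L cos^2 x)] over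
    [[0, PI / 2]],
    [exp (- t) * I0 t = 2 / PI * K (2 t)]   and
    [TQ a b = b * (2 / PI * K (ln (b / a)))].
    The second identity only uses [sin^2 + cos^2 = 1].  The first
    ([I0_integral]) expands [exp (- t cos (2 x))] in powers of [cos (2 x)] and
    integrates term by term; the odd moments vanish and the one of order [2 n]
    is Wallis's [PI / 2 * (2 n)! / (4^n n!^2)].  Together they give
    [TQ a b = b * exp (- t) * I0 t] with [t = ln (b / a) / 2] ([TQ_I0]), which
    makes the statements about [TQ] restatements of those about [I0].

    Upper bound ([I0_upper]): [exp (- u) < 1 / (1 + u)] for [u > 0].  Put
    [u = 2 t cos^2 x] under the integral; the average of
    [1 / (1 + c cos^2 x)] over a quarter period is exactly [1 / sqrt (1 + c)]
    ([is_RInt_inv_cos2]).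

    Lower bound ([I0_lower]): since [4^n n!^2 <= (2 n + 1)!], the series of [I0 t]
    dominates that of [sinh t / t] term by term, and
    [exp (- t) * (sinh t / t) = (1 - exp (- 2 t)) / (2 t)] exceeds
    [1 / (1 + 2 t)] because [exp (2 t) > 1 + 2 t].

    Both limits then follow by squeezing between [0] and [1 / sqrt (1 + 2 t)]. *)

(** * Integrating the exponential series term by term *)

Lemma is_series_exp (x : R) : is_series (fun k => x ^ k / INR (fact k)) (exp x).
Proof.
  apply is_series_ext with (2 := is_exp_Reals x).
  intros k. rewrite pow_n_pow. reflexivity.
Qed.

(** The Taylor remainder is a power series with nonnegative coefficients, so its
    absolute value is largest at the positive end of [[- T, T]].  This is the
    uniform error bound that allows integration term by term. *)
Lemma exp_remainder_le (x T : R) (N : nat) :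
  Rabs x <= T ->
  Rabs (exp x - sum_n (fun k => x ^ k / INR (fact k)) N)
  <= exp T - sum_n (fun k => T ^ k / INR (fact k)) N.
Proof.
  intros HxT.
  assert (Hrem : forall y,
    exp y - sum_n (fun k => y ^ k / INR (fact k)) N
    = Series (fun k => y ^ (S N + k) / INR (fact (S N + k)))).
  { intros y. rewrite <- (is_series_unique _ _ (is_series_exp y)).
    rewrite (Series_incr_n _ (S N)); [|lia|eexists; apply is_series_exp].
    rewrite sum_n_Reals. simpl pred. ring. }
  assert (Htail : ex_series (fun k => T ^ (S N + k) / INR (fact (S N + k)))).
  { apply (ex_series_incr_n (fun k => T ^ k / INR (fact k))).
    eexists; apply is_series_exp. }
  assert (Hle : forall k, 0 <= Rabs (x ^ (S N + k) / INR (fact (S N + k)))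
                          <= T ^ (S N + k) / INR (fact (S N + k))).
  { intros k. split; [apply Rabs_pos|].
    rewrite Rabs_div by apply INR_fact_neq_0.
    rewrite (Rabs_pos_eq (INR _)) by apply pos_INR.
    apply Rmult_le_compat_r;
      [left; apply Rinv_0_lt_compat, INR_fact_lt_0|].
    rewrite <- RPow_abs. apply pow_incr. split; [apply Rabs_pos|exact HxT]. }
  rewrite !Hrem.
  eapply Rle_trans; [apply Series_Rabs|apply Series_le]; trivial.
  apply (ex_series_le (V := R_CompleteNormedModule)) with (2 := Htail).
  intros k. change norm with Rabs. simpl Rabs. rewrite Rabs_Rabsolu. apply Hle.
Qed.

(** The partial sums of [exp (f x)] are uniformly close to it by
    [exp_remainder_le], so their integrals converge to its integral. *)
Lemma is_series_moments_exp (f : R -> R) (M : nat -> R) (a b T : R) :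
  a <= b ->
  (forall x, a <= x <= b -> Rabs (f x) <= T) ->
  (forall k, is_RInt (fun x => f x ^ k) a b (M k)) ->
  ex_RInt (fun x => exp (f x)) a b ->
  is_series (fun k => M k / INR (fact k)) (RInt (fun x => exp (f x)) a b).
Proof.
  intros Hab Hbound HM Hex.
  assert (HS : forall N,
    is_RInt (fun x => sum_n (fun k => f x ^ k / INR (fact k)) N) a b
            (sum_n (fun k => M k / INR (fact k)) N)).
  { assert (Hterm : forall k, is_RInt (fun x => f x ^ k / INR (fact k)) a b
                                      (M k / INR (fact k))).
    { intros k.
      apply (is_RInt_ext (fun x => scal (/ INR (fact k)) (f x ^ k))).
      - intros x _. change scal with Rmult. apply Rmult_comm.
      - replace (M k / _) with (scal (/ INR (fact k)) (M k)) by apply Rmult_comm.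
        apply (is_RInt_scal (V := R_NormedModule)), HM. }
    induction N as [|N IH].
    - rewrite sum_O. eapply is_RInt_ext; [|apply Hterm].
      intros x _. now rewrite sum_O.
    - rewrite sum_Sn. eapply is_RInt_ext;
        [|apply (is_RInt_plus (V := R_NormedModule)); [apply IH|apply Hterm]].
      intros x _. now rewrite sum_Sn. }
  assert (Herr : is_lim_seq
    (fun N => (b - a) * (exp T - sum_n (fun k => T ^ k / INR (fact k)) N)) 0).
  { replace 0 with ((b - a) * (exp T - exp T)) by ring.
    apply (is_lim_seq_scal_l _ _ (Finite _)).
    apply is_lim_seq_minus'; [apply is_lim_seq_const|apply is_series_exp]. }
  set (I := RInt (fun x => exp (f x)) a b : R).
  assert (Hdist : is_lim_seq
    (fun N => sum_n (fun k => M k / INR (fact k)) N - I) 0).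
  { apply is_lim_seq_abs_0.
    apply (is_lim_seq_le_le (fun _ => 0)) with (3 := Herr);
      [|apply is_lim_seq_const].
    intros N. split; [apply Rabs_pos|].
    rewrite Rabs_minus_sym. unfold I.
    rewrite <- (is_RInt_unique _ _ _ _ (HS N)).
    assert (HexN := ex_intro _ _ (HS N) : ex_RInt _ a b).
    change (RInt ?u a b - RInt ?v a b) with (minus (RInt u a b) (RInt v a b)).
    rewrite <- (RInt_minus (V := R_CompleteNormedModule)) by assumption.
    apply abs_RInt_le_const; [exact Hab| |].
    - now apply (ex_RInt_minus (V := R_NormedModule)).
    - intros x Hx. now apply exp_remainder_le, Hbound. }
  assert (Hsum : is_lim_seq
    (fun N => (sum_n (fun k => M k / INR (fact k)) N - I) + I) (0 + I)).
  { apply is_lim_seq_plus'; [exact Hdist|apply is_lim_seq_const]. }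
  rewrite Rplus_0_l in Hsum.
  revert Hsum. apply is_lim_seq_ext. intros N. unfold Rminus. rewrite Rplus_assoc, Rplus_opp_l. apply Rplus_0_r.
Qed.

(** The partial sums of the even terms are a subsequence of the partial sums of
    the whole series. *)
Lemma is_series_even_terms (a : nat -> R) (l : R) :
  (forall n, a (S (2 * n)) = 0) -> is_series a l ->
  is_series (fun n => a (2 * n)%nat) l.
Proof.
  intros Hodd Ha.
  change (is_lim_seq (sum_n (fun n => a (2 * n)%nat)) l).
  apply (is_lim_seq_ext (fun n => sum_n a (2 * n))).
  - induction n as [|n IH].
    + now rewrite !sum_O.
    + replace (2 * S n)%nat with (S (S (2 * n))) by lia.
      rewrite !sum_Sn, IH, Hodd.
      replace (2 * S n)%nat with (S (S (2 * n))) by lia.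
      change plus with Rplus. ring.
  - apply (is_lim_seq_subseq (sum_n a) l (fun n => (2 * n)%nat)); [|exact Ha].
    apply eventually_subseq. intros n. lia.
Qed.

(** * Moments of cos (2 x) over a quarter period *)

Definition cos_moment (k : nat) : R := RInt (fun x => cos (2 * x) ^ k) 0 (PI / 2).

Lemma is_RInt_cos_moment (k : nat) :
  is_RInt (fun x => cos (2 * x) ^ k) 0 (PI / 2) (cos_moment k).
Proof.
  apply (RInt_correct (V := R_CompleteNormedModule)).
  apply (ex_RInt_continuous (V := R_CompleteNormedModule)).
  intros x _. apply (ex_derive_continuous (V := R_NormedModule)). auto_derive. trivial.
Qed.

(** The function [(n + 2) cos^(n+2) (2 x) - (n + 1) cos^n (2 x)] is the derivative
    of [cos^(n+1) (2 x) sin (2 x) / 2], which vanishes at both ends. *)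
Lemma cos_moment_step (n : nat) :
  INR (n + 2) * cos_moment (n + 2) = INR (n + 1) * cos_moment n.
Proof.
  set (g := fun x => INR (n + 2) * cos (2 * x) ^ (n + 2) - INR (n + 1) * cos (2 * x) ^ n).
  assert (H1 : is_RInt g 0 (PI / 2)
                 (INR (n + 2) * cos_moment (n + 2) - INR (n + 1) * cos_moment n)).
  { apply (is_RInt_minus (V := R_NormedModule));
      apply (is_RInt_scal (V := R_NormedModule)), is_RInt_cos_moment. }
  assert (H2 : is_RInt g 0 (PI / 2)
    (cos (2 * (PI / 2)) ^ (n + 1) * sin (2 * (PI / 2)) / 2
     - cos (2 * 0) ^ (n + 1) * sin (2 * 0) / 2)).
  { apply (is_RInt_derive (V := R_CompleteNormedModule)
             (fun x => cos (2 * x) ^ (n + 1) * sin (2 * x) / 2)).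
    - intros x _. unfold g. auto_derive; [trivial|].
      replace (pred (n + 1)) with n by lia.
      rewrite !plus_INR, !pow_add. simpl (INR _).
      assert (Hs : sin (2 * x) * sin (2 * x) = 1 - cos (2 * x) * cos (2 * x)).
      { generalize (sin2_cos2 (2 * x)). unfold Rsqr. lra. }
      transitivity ((INR n + 1) * - (sin (2 * x) * sin (2 * x)) * cos (2 * x) ^ n
                    + cos (2 * x) ^ n * cos (2 * x) * cos (2 * x)); [field|].
      rewrite Hs. field.
    - intros x _. apply (ex_derive_continuous (V := R_NormedModule)).
      unfold g. auto_derive. trivial. }
  rewrite Rmult_0_r, sin_0 in H2.
  replace (2 * (PI / 2)) with PI in H2 by field. rewrite sin_PI in H2.
  generalize (is_RInt_unique _ _ _ _ H1). rewrite (is_RInt_unique _ _ _ _ H2). lra.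
Qed.

Lemma cos_moment_odd (n : nat) : cos_moment (S (2 * n)) = 0.
Proof.
  induction n as [|n IH].
  - assert (H : is_RInt (fun x => cos (2 * x) ^ 1) 0 (PI / 2)
                  (sin (2 * (PI / 2)) / 2 - sin (2 * 0) / 2)).
    { apply (is_RInt_derive (V := R_CompleteNormedModule) (fun x => sin (2 * x) / 2)).
      - intros x _. auto_derive; [trivial|field].
      - intros x _. apply (ex_derive_continuous (V := R_NormedModule)).
        auto_derive. trivial. }
    unfold cos_moment. simpl (S _). rewrite (is_RInt_unique _ _ _ _ H).
    rewrite Rmult_0_r, sin_0. replace (2 * (PI / 2)) with PI by field.
    rewrite sin_PI. field.
  - generalize (cos_moment_step (S (2 * n))). rewrite IH, Rmult_0_r.
    replace (S (2 * n) + 2)%nat with (S (2 * S n)) by lia.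
    intros H. apply Rmult_integral in H. destruct H as [H|H]; [|exact H].
    apply not_0_INR in H; [easy|lia].
Qed.

Lemma cos_moment_even (n : nat) :
  cos_moment (2 * n) = PI / 2 * (INR (fact (2 * n)) / (2 ^ (2 * n) * INR (fact n) ^ 2)).
Proof.
  induction n as [|n IH].
  - unfold cos_moment. simpl. rewrite RInt_const. change scal with Rmult. simpl. field.
  - generalize (cos_moment_step (2 * n)). rewrite IH.
    replace (2 * n + 2)%nat with (2 * S n)%nat by lia.
    replace (fact (2 * S n)) with ((2 * S n) * ((2 * n + 1) * fact (2 * n)))%nat
      by (replace (2 * S n)%nat with (S (S (2 * n))) by lia; rewrite !fact_simpl; lia).
    replace (2 ^ (2 * S n)) with (4 * 2 ^ (2 * n))
      by (replace (2 * S n)%nat with (2 + 2 * n)%nat by lia; rewrite pow_add; ring).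
    rewrite fact_simpl, !mult_INR, (S_INR n).
    intros H.
    assert (Hn := pos_INR n).
    change (INR 2) with (1 + 1) in *.
    apply (Rmult_eq_reg_l ((1 + 1) * (INR n + 1))); [|lra].
    rewrite H. field.
    repeat split; [apply INR_fact_neq_0 | lra | apply pow_nonzero; lra].
Qed.

(** * Integral representations of the Bessel function and of the mean *)

Definition exp_cos2_integral (L : R) : R :=
  RInt (fun x => exp (- L * cos x ^ 2)) 0 (PI / 2).

Lemma continuous_exp_cos2 (L x : R) : continuous (fun x => exp (- L * cos x ^ 2)) x.
Proof.
  apply (ex_derive_continuous (V := R_NormedModule)). auto_derive. trivial.
Qed.

(** Since [- t cos (2 x) = t - 2 t cos^2 x], the integral of [exp (- t cos (2 x))]
    is [exp t] times [exp_cos2_integral (2 t)]; its expansion in moments of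
    [cos (2 x)] has only even terms. *)
Lemma is_series_I0 (t : R) :
  is_series (fun n => t ^ (2 * n) / (2 ^ (2 * n) * INR (fact n) ^ 2))
            (exp t * (2 / PI * exp_cos2_integral (2 * t))).
Proof.
  assert (HPI := PI_RGT_0).
  set (J := RInt (fun x => exp (- t * cos (2 * x))) 0 (PI / 2)).
  assert (Hex : ex_RInt (fun x => exp (- t * cos (2 * x))) 0 (PI / 2)).
  { apply (ex_RInt_continuous (V := R_CompleteNormedModule)). intros x _.
    apply (ex_derive_continuous (V := R_NormedModule)). auto_derive. trivial. }
  assert (HJ : is_series (fun k => (- t) ^ k * cos_moment k / INR (fact k)) J).
  { apply (is_series_moments_exp _ _ _ _ (Rabs t)); [lra| | |exact Hex].
    - intros x _. rewrite Rabs_mult, Rabs_Ropp.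
      rewrite <- (Rmult_1_r (Rabs t)) at 2.
      apply Rmult_le_compat_l; [apply Rabs_pos|].
      apply Rabs_le, COS_bound.
    - intros k. apply (is_RInt_ext (fun x => scal ((- t) ^ k) (cos (2 * x) ^ k))).
      + intros x _. change scal with Rmult. symmetry. apply Rpow_mult_distr.
      + apply (is_RInt_scal (V := R_NormedModule)), is_RInt_cos_moment. }
  apply is_series_even_terms in HJ;
    [|intros n; rewrite cos_moment_odd; field; apply INR_fact_neq_0].
  assert (HK : exp t * (2 / PI * exp_cos2_integral (2 * t)) = 2 / PI * J).
  { replace J with (exp t * exp_cos2_integral (2 * t)); [ring|].
    unfold J, exp_cos2_integral.
    change (exp t * RInt ?f 0 (PI / 2)) with (scal (exp t) (RInt f 0 (PI / 2))).
    rewrite <- (RInt_scal (V := R_CompleteNormedModule)).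
    - apply RInt_ext. intros x _. change scal with Rmult. simpl.
      rewrite <- exp_plus, cos_2a_cos. f_equal. ring.
    - apply (ex_RInt_continuous (V := R_CompleteNormedModule)).
      intros x _. apply continuous_exp_cos2. }
  rewrite HK.
  apply (is_series_ext (fun n =>
    2 / PI * ((- t) ^ (2 * n) * cos_moment (2 * n) / INR (fact (2 * n)))));
    [|exact (is_series_scal (V := R_NormedModule) _ _ _ HJ)].
  intros n. rewrite cos_moment_even.
  rewrite (pow_mult (- t)). replace ((- t) ^ 2) with (t ^ 2) by ring.
  rewrite <- pow_mult. match goal with |- ?x = ?y => change (x = y :> R) end. field.
  repeat split; try apply INR_fact_neq_0; [apply pow_nonzero|]; lra.
Qed.

Lemma I0_integral (t : R) :
  exp (- t) * I0 t = 2 / PI * exp_cos2_integral (2 * t).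
Proof.
  unfold I0. rewrite (is_series_unique _ _ (is_series_I0 t)).
  rewrite <- Rmult_assoc, <- exp_plus, Rplus_opp_l, exp_0. ring.
Qed.

Lemma TQ_integral (a b : R) : 0 < a -> 0 < b ->
  TQ a b = b * (2 / PI * exp_cos2_integral (ln (b / a))).
Proof.
  intros Ha Hb. unfold TQ.
  replace (RInt _ 0 (PI / 2)) with (b * exp_cos2_integral (ln (b / a))); [ring|].
  unfold exp_cos2_integral.
  change (b * RInt ?f 0 (PI / 2)) with (scal b (RInt f 0 (PI / 2))).
  rewrite <- (RInt_scal (V := R_CompleteNormedModule)).
  - apply RInt_ext. intros x _. change scal with Rmult. simpl.
    unfold Rpower. rewrite ln_div by assumption.
    rewrite <- (exp_ln b) at 1 by assumption. rewrite <- !exp_plus. f_equal.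
    generalize (sin2_cos2 x). unfold Rsqr. intros H.
    replace (sin x * (sin x * 1)) with (1 - cos x * cos x) by lra. ring.
  - apply (ex_RInt_continuous (V := R_CompleteNormedModule)).
    intros x _. apply continuous_exp_cos2.
Qed.

Lemma TQ_I0 (a b : R) : 0 < a -> 0 < b ->
  TQ a b = b * (exp (- (ln (b / a) / 2)) * I0 (ln (b / a) / 2)).
Proof.
  intros Ha Hb. rewrite I0_integral, TQ_integral by assumption.
  now replace (2 * (ln (b / a) / 2)) with (ln (b / a)) by field.
Qed.

(** * Upper bound *)

(** The usual antiderivative [atan (tan x / k) / k], where [k = sqrt (1 + c)],
    breaks down at [PI / 2].  The addition formula for [tan] rewrites it as
    [F x = (x - atan ((k - 1) sin x cos x / (k cos^2 x + sin^2 x))) / k], which is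
    smooth on the closed interval and whose [atan] part vanishes at both
    ends. *)
Lemma is_RInt_inv_cos2 (c : R) : 0 <= c ->
  is_RInt (fun x => / (1 + c * cos x ^ 2)) 0 (PI / 2) (PI / 2 / sqrt (1 + c)).
Proof.
  intros Hc.
  set (k := sqrt (1 + c)).
  assert (Hk2 : k * k = 1 + c) by (apply sqrt_sqrt; lra).
  assert (Hk : 0 < k) by (apply sqrt_lt_R0; lra).
  assert (Hsc : forall x, sin x * sin x = 1 - cos x * cos x).
  { intros x. generalize (sin2_cos2 x). unfold Rsqr. lra. }
  assert (Hden : forall x, 0 < k * (cos x * cos x) + sin x * sin x).
  { intros x. rewrite Hsc.
    assert (0 <= cos x * cos x <= 1).
    { generalize (Hsc x) (Rle_0_sqr (sin x)) (Rle_0_sqr (cos x)). unfold Rsqr. lra. }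
    nra. }
  assert (Hpos : forall x, 0 < 1 + c * cos x ^ 2).
  { intros x. generalize (pow2_ge_0 (cos x)). nra. }
  set (F := fun x => (x - atan ((k - 1) * sin x * cos x
                               / (k * (cos x * cos x) + sin x * sin x))) / k).
  replace (PI / 2 / k) with (minus (F (PI / 2)) (F 0)).
  - apply (is_RInt_derive (V := R_CompleteNormedModule)).
    + intros x _. unfold F. auto_derive; [generalize (Hden x); lra|].
      specialize (Hsc x). specialize (Hden x). specialize (Hpos x). revert Hsc Hden Hpos.
      generalize (sin x) (cos x). intros s q Hsc Hden Hpos.
      replace c with (k * k - 1) in * by lra.
      (* The sum of these two squares is the denominator of the derivative of
         [atan]. *)
      assert (HN := Rmult_lt_0_compat _ _ Hden Hden).
      assert (HM := Rle_0_sqr ((k - 1) * s * q)). unfold Rsqr in HM.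
      field [Hsc]. repeat split; lra.
    + intros x _. apply (ex_derive_continuous (V := R_NormedModule)).
      auto_derive. generalize (Hpos x); simpl; lra.
  - replace (F (PI / 2)) with (PI / 2 / k).
    + replace (F 0) with 0; [apply Rminus_0_r|].
      unfold F. rewrite sin_0, Rmult_0_r, Rmult_0_l, Rdiv_0_l, atan_0. field. lra.
    + unfold F. rewrite cos_PI2, Rmult_0_r, Rdiv_0_l, atan_0. field. lra.
Qed.

Lemma I0_upper (t : R) : 0 < t -> exp (- t) * I0 t < / sqrt (1 + 2 * t).
Proof.
  intros Ht. assert (HPI := PI_RGT_0).
  rewrite I0_integral.
  replace (/ sqrt (1 + 2 * t)) with (2 / PI * (PI / 2 / sqrt (1 + 2 * t))).
  2:{ field. split; [|lra]. generalize (sqrt_lt_R0 (1 + 2 * t)). lra. }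
  apply Rmult_lt_compat_l; [apply Rdiv_lt_0_compat; lra|].
  rewrite <- (is_RInt_unique _ _ _ _ (is_RInt_inv_cos2 (2 * t) ltac:(lra))).
  apply RInt_lt; [lra| | |].
  - intros x _. apply (ex_derive_continuous (V := R_NormedModule)).
    auto_derive. generalize (pow2_ge_0 (cos x)); simpl; nra.
  - intros x _. apply continuous_exp_cos2.
  - intros x Hx.
    assert (Hc : 0 < cos x) by (apply cos_gt_0; lra).
    assert (0 < 2 * t * cos x ^ 2) by (apply Rmult_lt_0_compat; [lra|now apply pow_lt]).
    rewrite Ropp_mult_distr_l_reverse, exp_Ropp.
    apply Rinv_lt_contravar; [apply Rmult_lt_0_compat; [lra|apply exp_pos]|].
    apply exp_ineq1. lra.
Qed.

(** * Lower bound *)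

Lemma fact_odd_ge (n : nat) : 2 ^ (2 * n) * INR (fact n) ^ 2 <= INR (fact (S (2 * n))).
Proof.
  induction n as [|n IH]; [simpl; lra|].
  replace (fact (S (2 * S n))) with ((2 * n + 3) * ((2 * n + 2) * fact (S (2 * n))))%nat
    by (replace (2 * S n)%nat with (S (S (2 * n))) by lia;
        rewrite (fact_simpl (S (S (2 * n)))), (fact_simpl (S (2 * n))); lia).
  replace (2 ^ (2 * S n)) with (4 * 2 ^ (2 * n))
    by (replace (2 * S n)%nat with (2 + 2 * n)%nat by lia; rewrite pow_add; ring).
  rewrite fact_simpl, !mult_INR, !plus_INR, mult_INR, (S_INR n). simpl (INR 2). simpl (INR 3).
  assert (Hn := pos_INR n).
  apply Rle_trans with (4 * (INR n + 1) ^ 2 * (2 ^ (2 * n) * INR (fact n) ^ 2));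
    [right; ring|].
  apply Rle_trans with (4 * (INR n + 1) ^ 2 * INR (fact (S (2 * n)))).
  - apply Rmult_le_compat_l; [nra|exact IH].
  - rewrite <- Rmult_assoc. apply Rmult_le_compat_r; [apply pos_INR|nra].
Qed.

(** The odd terms of [(exp t - exp (- t)) / (2 t)], reached as the even terms of
    the shifted series. *)
Lemma is_series_sinh_div (t : R) : t <> 0 ->
  is_series (fun n => t ^ (2 * n) / INR (fact (S (2 * n)))) (sinh t / t).
Proof.
  intros Ht.
  set (s := fun k => (t ^ k - (- t) ^ k) / (2 * t) / INR (fact k)).
  assert (Hs : is_series s (sinh t / t)).
  { apply (is_series_ext (fun k => scal (/ (2 * t))
             (minus (t ^ k / INR (fact k)) ((- t) ^ k / INR (fact k))))).
    - intros k. unfold s. change scal with Rmult. change minus with Rminus.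
      simpl. field. split; [exact Ht|apply INR_fact_neq_0].
    - replace (sinh t / t) with (scal (/ (2 * t)) (minus (exp t) (exp (- t)))).
      + apply (is_series_scal (V := R_NormedModule)).
        apply (is_series_minus (V := R_NormedModule)); apply is_series_exp.
      + unfold sinh. change scal with Rmult. change minus with Rminus.
        simpl. field. exact Ht. }
  assert (Hparity : forall n, (- t) ^ (2 * n) = t ^ (2 * n)).
  { intros n. rewrite !pow_mult. f_equal. ring. }
  apply (is_series_ext (fun n => s (S (2 * n)))).
  { intros n. unfold s. rewrite <- !tech_pow_Rmult. rewrite Hparity.
    match goal with |- ?x = ?y => change (x = y :> R) end.
    field. split; [apply INR_fact_neq_0|exact Ht]. }
  apply (is_series_even_terms (fun k => s (S k))).
  - intros n. unfold s. replace (S (S (2 * n))) with (2 * S n)%nat by lia.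
    rewrite Hparity. field. split; [exact Ht|apply INR_fact_neq_0].
  - apply (is_series_incr_1 (V := R_NormedModule)).
    replace (plus _ _) with (sinh t / t); [exact Hs|].
    unfold s. change plus with Rplus. simpl. field. exact Ht.
Qed.

Lemma I0_lower (t : R) : 0 < t -> / (1 + 2 * t) < exp (- t) * I0 t.
Proof.
  intros Ht.
  assert (Hle : sinh t / t <= I0 t).
  { rewrite <- (is_series_unique _ _ (is_series_sinh_div t ltac:(lra))).
    apply Series_le; [|eexists; apply is_series_I0].
    intros n.
    assert (Hp : 0 < t ^ (2 * n)) by (apply pow_lt; exact Ht).
    assert (Hf := INR_fact_lt_0 (S (2 * n))).
    assert (Hd : 0 < 2 ^ (2 * n) * INR (fact n) ^ 2).
    { apply Rmult_lt_0_compat; apply pow_lt; [lra|apply INR_fact_lt_0]. }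
    split; [now apply Rlt_le, Rdiv_lt_0_compat|].
    apply Rmult_le_compat_l; [lra|].
    apply Rinv_le_contravar; [exact Hd|apply fact_odd_ge]. }
  assert (He := exp_pos (- t)).
  apply Rlt_le_trans with (exp (- t) * (sinh t / t));
    [|apply Rmult_le_compat_l; lra].
  unfold sinh.
  replace (exp (- t) * ((exp t - exp (- t)) / 2 / t))
    with ((1 - exp (- (2 * t))) / (2 * t)).
  2:{ replace (- (2 * t)) with (- t + - t) by ring.
      rewrite exp_plus, (exp_Ropp t). field.
      generalize (exp_pos t). split; lra. }
  assert (Hinv : exp (- (2 * t)) < / (1 + 2 * t)).
  { rewrite exp_Ropp. apply Rinv_lt_contravar.
    - apply Rmult_lt_0_compat; [lra|apply exp_pos].
    - apply exp_ineq1. lra. }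
  replace (/ (1 + 2 * t)) with ((1 - / (1 + 2 * t)) / (2 * t)) by (field; lra).
  apply Rmult_lt_compat_r; [apply Rinv_0_lt_compat|]; lra.
Qed.

(** * The bounds and the limits *)

Theorem mainTheorem9 :
  (forall t : R, 0 < t ->
     exp t / (1 + 2 * t) < I0 t < exp t / sqrt (1 + 2 * t)) /\
  (forall a b : R, 0 < a -> a < b ->
     b / (1 + ln (b / a)) < TQ a b < b / sqrt (1 + ln (b / a))) /\
  is_lim (fun t : R => exp (- t) * I0 t) p_infty 0 /\
  filterlim (fun x : R => TQ x 1) (at_right 0) (locally 0).
Proof.
  assert (Hlim : is_lim (fun t => exp (- t) * I0 t) p_infty 0).
  { apply (is_lim_le_le_loc (fun _ => 0) (fun t => / sqrt (1 + 2 * t))).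
    - exists 0. intros t Ht. split; [|now apply Rlt_le, I0_upper].
      apply Rle_trans with (/ (1 + 2 * t)); [|now apply Rlt_le, I0_lower].
      apply Rlt_le, Rinv_0_lt_compat. lra.
    - apply is_lim_const.
    - apply (is_lim_inv _ _ p_infty); [|easy].
      apply (filterlim_comp _ _ _ (fun t => 1 + 2 * t) sqrt _ (Rbar_locally p_infty));
        [|apply filterlim_sqrt_p].
      intros P [M HM]. exists (Rmax M 0). intros t Ht. apply HM.
      generalize (Rmax_l M 0) (Rmax_r M 0). lra. }
  split; [|split; [|split; [exact Hlim|]]].
  - intros t Ht.
    replace (I0 t) with (exp t * (exp (- t) * I0 t))
      by (rewrite exp_Ropp; field; apply exp_neq_0).
    assert (He := exp_pos t).
    split; apply Rmult_lt_compat_l; trivial; [now apply I0_lower|now apply I0_upper].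
  - intros a b Ha Hab.
    rewrite TQ_I0 by lra.
    assert (Ht : 0 < ln (b / a) / 2).
    { apply Rdiv_lt_0_compat; [|lra]. rewrite <- ln_1. apply ln_increasing; [lra|].
      apply (Rmult_lt_reg_r a); [exact Ha|]. field_simplify; lra. }
    generalize (I0_lower _ Ht) (I0_upper _ Ht).
    replace (2 * (ln (b / a) / 2)) with (ln (b / a)) by field. intros Hlow Hup.
    split; apply Rmult_lt_compat_l; lra.
  - apply (filterlim_ext_loc (fun x => exp (- (- ln x / 2)) * I0 (- ln x / 2))).
    { exists (mkposreal 1 Rlt_0_1). intros x _ Hx.
      rewrite TQ_I0 by lra. rewrite Rmult_1_l.
      replace (ln (1 / x)) with (- ln x); [reflexivity|].
      rewrite Rdiv_1_l, ln_Rinv; trivial. }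
    apply (filterlim_comp _ _ _ (fun x => - ln x / 2)
             (fun t => exp (- t) * I0 t) _ (Rbar_locally p_infty)); [|exact Hlim].
    intros P [M HM].
    (* As [x] decreases to [0], [t = ln (1 / x) / 2] tends to infinity. *)
    change (at_right 0 (fun x => P (- ln x / 2))).
    apply (filter_imp (fun x => ln x < - (2 * M))).
    + intros x Hx. apply HM. lra.
    + apply (is_lim_ln_0 (fun y => y < - (2 * M))). exists (- (2 * M)). trivial.
Qed.
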